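(* Let $S=L-ZJ^{-1}Y\in\mathbb{R}^{s\times s}$ be the Schur complement of an abs-normal form of a piecewise linear function $F:\mathbb{R}^n\to\mathbb{R}^n$ with $\det J\ne0$, and let $H(z)=z-S|z|$ for $z\in\mathbb{R}^s$. If $\rho=\|S\|_p<1/3$ for some $p$-norm, then for every $\hat c\in\mathbb{R}^s$ the generalized Newton iteration $$z^+=z-A^{-1}(H(z)-\hat c),\qquad A\in\partial^LH(z),$$ converges in finitely many iterations from every $z_0\in\mathbb{R}^s$ to the unique solution $z_*=H^{-1}(\hat c)$. Moreover, the $p$-norms of both $z-z_*$ and $H(z)-\hat c$ are monotonically reduced along the iteration.
   Context: Abs-normal form: $z=c+Zx+L|z|$, $F(x)=b+Jx+Y|z|$, with $c\in\mathbb{R}^s$, $b\in\mathbb{R}^n$, $Z\in\mathbb{R}^{s\times n}$, $L\in\mathbb{R}^{s\times s}$ strictly lower triangular, $J\in\mathbb{R}^{n\times n}$, $Y\in\mathbb{R}^{n\times s}$; $|\cdot|$ acts componentwise. $\|\cdot\|_p$, $1\le p\le\infty$, denotes the vector $p$-norm and its induced matrix norm. The limiting Jacobian $\partial^LH(z)$ is the set of all limits of Jacobians of $H$ at points of differentiability converging to $z$; explicitly, $\partial^LH(z)=\{I-S\,\mathrm{diag}(\sigma):\sigma\in\{-1,1\}^s,\ \sigma_iz_i=|z_i|\text{ for all }i\}$. In each step an arbitrary element $A$ of $\partial^LH(z)$ at the current iterate $z$ may be chosen. *)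

(* Defs.v *)
From HB Require Import structures.
From mathcomp Require Import all_boot all_order all_algebra.
From mathcomp Require Import all_classical all_reals all_analysis.

Set Implicit Arguments.
Unset Strict Implicit.
Unset Printing Implicit Defensive.

Import Order.TTheory GRing.Theory Num.Theory.
Import numFieldNormedType.Exports.

Local Open Scope classical_set_scope.
Local Open Scope ring_scope.

(* The componentwise absolute value. The library's [`|v|] on matrices is
   the max norm, hence the separate name. *)
Definition cabs (R : realType) (n : nat) (v : 'cV[R]_n) : 'cV[R]_n :=
  map_mx (fun t : R => `|t|) v.

(* The value at [p = -oo] is irrelevant: p-norms are used only for
   [1 <= p]. *)
Definition pnorm (R : realType) (p : \bar R) (n : nat) (v : 'cV[R]_n) : R :=
  match p with
  | EFin r => (\sum_(i < n) `|v i 0| `^ r) `^ r^-1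
  | +oo%E => \big[Num.max/0]_(i < n) `|v i 0|
  | -oo%E => 0
  end.

(* The closed unit ball, unlike the unit sphere, is nonempty also when
   [n = 0]. *)
Definition induced_norm (R : realType) (p : \bar R) (m n : nat)
    (A : 'M[R]_(m, n)) : R :=
  sup [set pnorm p (A *m v) | v in [set v : 'cV[R]_n | pnorm p v <= 1]].

(* Since [L] is strictly lower triangular, the switching equation has exactly
   one solution [z] for each [x]; [F] is then automatically piecewise
   linear. *)
Definition abs_normal_form (R : realType) (n s : nat)
    (F : 'cV[R]_n -> 'cV[R]_n) (c : 'cV[R]_s) (b : 'cV[R]_n)
    (Z : 'M[R]_(s, n)) (L : 'M[R]_s) (J : 'M[R]_n) (Y : 'M[R]_(n, s)) : Prop :=
  (forall i j : 'I_s, (i <= j)%N -> L i j = 0) /\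
  (forall x : 'cV[R]_n, exists z : 'cV[R]_s,
     z = c + Z *m x + L *m cabs z /\ F x = b + J *m x + Y *m cabs z).

Definition schur_complement (R : realType) (n s : nat)
    (Z : 'M[R]_(s, n)) (L : 'M[R]_s) (J : 'M[R]_n) (Y : 'M[R]_(n, s)) :
    'M[R]_s :=
  L - Z *m invmx J *m Y.

Definition abs_map (R : realType) (s : nat) (S : 'M[R]_s) (z : 'cV[R]_s) :
    'cV[R]_s :=
  z - S *m cabs z.

(* The library's ['J f y] is for maps between row vectors and acts on the
   right; this one acts on column vectors from the left. *)
Definition cjacobian (R : realType) (m n : nat) (f : 'cV[R]_m -> 'cV[R]_n)
    (y : 'cV[R]_m) : 'M[R]_(n, m) :=
  \matrix_(i < n, j < m) ('D_(delta_mx j 0) f y) i 0.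

Definition limiting_jacobian (R : realType) (m n : nat)
    (f : 'cV[R]_m -> 'cV[R]_n) (z : 'cV[R]_m) : set 'M[R]_(n, m) :=
  [set A | exists y : nat -> 'cV[R]_m,
     [/\ forall k, differentiable f (y k),
         y @ \oo --> z &
         (fun k => cjacobian f (y k)) @ \oo --> A]].

(* [invmx A] is the inverse only for [A \in unitmx], which has to be
   established separately. *)
Definition newton_iteration (R : realType) (s : nat)
    (H : 'cV[R]_s -> 'cV[R]_s) (chat z0 : 'cV[R]_s) (z : nat -> 'cV[R]_s) :
    Prop :=
  z 0%N = z0 /\
  (forall k, exists2 A : 'M[R]_s, limiting_jacobian H (z k) A &
     z k.+1 = z k - invmx A *m (H (z k) - chat)).

(* Main.v *)
Require Import Defs.
From HB Require Import structures.
From mathcomp Require Import all_boot all_order all_algebra.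
From mathcomp Require Import all_classical all_reals all_analysis.
From mathcomp Require Import ring lra.

Set Implicit Arguments.
Unset Strict Implicit.
Unset Printing Implicit Defensive.

Import Order.TTheory GRing.Theory Num.Theory.
Import numFieldNormedType.Exports.

Local Open Scope classical_set_scope.
Local Open Scope ring_scope.

(** Write [D] for the diagonal matrix of a sign vector and [A = I - S D].

    If the signs of [D] agree with those of [z], then [D z = |z|], hence
    [H z = A z], and a Newton step from [z] is the solution of the linear
    system [A z' = chat]. For any other point [w] one has
    [H w - A w = S (D w - |w|)]. A coordinate of [D w - |w|] is nonzero only
    if [w_i] has the sign opposite to that of [D]; as [D] agrees with [z], 0
    lies between [w_i] and [z_i], and the modulus of that coordinate is
    [2 |w_i| <= 2 |w_i - z_i|]. So, with [rho] the induced norm of [S],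
    [|H w - A w| <= 2 rho |w - z|] ([selection_mx_defect]). The second
    ingredient is [(1 - rho) |v| <= |A v|] ([selection_mx_lower]).

    Taking [w] to be a solution, these two bounds show that a step multiplies
    the error by at most [2 rho / (1 - rho)]; taking [w = z'], that it
    multiplies the residual by at most the same factor. This factor is less
    than 1 because [rho < 1/3].

    Solvability and finite termination then rest on the fact that there are
    only finitely many sign vectors. Among the finitely many points
    [A^-1 chat], one with the least residual must be a solution, as a Newton
    step from it would lead to another such point with a smaller residual
    ([abs_map_surj]). And the iterates before the solution is reached have
    strictly decreasing residuals, so they are distinct; since each iterate
    but the first is determined by a sign vector, there are finitely many
    ([newton_finite_termination]).

    Finally, every limiting Jacobian of [H] at [z] is such a matrix [A] with
    signs agreeing with [z] ([limiting_jacobian_selection]). *)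

(** * The p-norm and its induced matrix norm *)

Lemma powR_inv (R : realType) (a r : R) : 0 <= a -> a^-1 `^ r = (a `^ r)^-1.
Proof.
by move=> a0; rewrite -(powR_inv1 a0) powRAC powR_inv1 // powR_ge0.
Qed.

Section PNorm.
Variables (R : realType) (p : \bar R).
Hypothesis p1 : (1 <= p)%E.

Lemma exponentP : (exists2 r : R, 1 <= r & p = r%:E) \/ p = +oo%E.
Proof.
have := p1; case: (p) => [r| |]; last by rewrite leeNy_eq.
  by rewrite lee_fin => r1; left; exists r.
by right.
Qed.

Lemma pnorm_ge0 n (v : 'cV[R]_n) : 0 <= pnorm p v.
Proof.
by case: (p) => [r| |] //=; [exact: powR_ge0 | exact: bigmax_ge_id].
Qed.

Lemma pnorm_mono n (u v : 'cV[R]_n) :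
  (forall i, `|u i 0| <= `|v i 0|) -> pnorm p u <= pnorm p v.
Proof.
have [[r r1 ->]|-> uv] := exponentP; last by apply: le_bigmax2 => i _.
move=> uv; have r0 : 0 <= r by apply: le_trans r1.
rewrite /pnorm; apply: ge0_ler_powR; first by rewrite invr_ge0.
- by rewrite nnegrE sumr_ge0 // => i _; exact: powR_ge0.
- by rewrite nnegrE sumr_ge0 // => i _; exact: powR_ge0.
by apply: ler_sum => i _; apply: ge0_ler_powR; rewrite ?nnegrE.
Qed.

Lemma sum_powR_pnorm (r : R) n (v : 'cV[R]_n) : 1 <= r ->
  \sum_(i < n) `|v i 0| `^ r = pnorm r%:E v `^ r.
Proof.
move=> r1; have r0 : r != 0 by rewrite gt_eqF// (lt_le_trans ltr01).
rewrite /pnorm -powRrM mulVf // powRr1 // sumr_ge0 // => i _; exact: powR_ge0.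
Qed.

Lemma pnorm_le_sum_powR (r c : R) n (v : 'cV[R]_n) : 1 <= r -> 0 <= c ->
  \sum_(i < n) `|v i 0| `^ r <= c `^ r -> pnorm r%:E v <= c.
Proof.
move=> r1 c0 vc; have r0 : 0 < r by rewrite (lt_le_trans ltr01).
have -> : c = (c `^ r) `^ r^-1 by rewrite -powRrM divff ?gt_eqF// powRr1.
apply: ge0_ler_powR; rewrite ?nnegrE ?invr_ge0 ?powR_ge0 ?(ltW r0) //.
by apply: sumr_ge0 => i _; exact: powR_ge0.
Qed.

(** Makes [pnorm] definite, and makes the unit ball bounded. *)
Lemma coord_le_pnorm n (v : 'cV[R]_n) i : `|v i 0| <= pnorm p v.
Proof.
have [[r r1 ->]|->] := exponentP; last exact: (le_bigmax 0 (fun i => `|v i 0|)).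
have r0 : 0 < r by rewrite (lt_le_trans ltr01).
rewrite leNgt; apply/negP => lt; have := gt0_ltr_powR r0 _ _ lt.
rewrite !nnegrE normr_ge0 powR_ge0 -sum_powR_pnorm // => /(_ isT isT).
rewrite ltNge (bigD1 i) //= lerDl sumr_ge0 // => j _; exact: powR_ge0.
Qed.

Lemma pnorm_eq0 n (v : 'cV[R]_n) : pnorm p v = 0 -> v = 0.
Proof.
move=> v0; apply/colP => i; rewrite mxE; apply/eqP.
by rewrite -normr_le0 -v0 coord_le_pnorm.
Qed.

Lemma pnorm_gt0 n (v : 'cV[R]_n) : v != 0 -> 0 < pnorm p v.
Proof.
move=> v0; rewrite lt_neqAle pnorm_ge0 andbT eq_sym.
by apply: contra_neq v0; exact: pnorm_eq0.
Qed.

Lemma pnormN n (v : 'cV[R]_n) : pnorm p (- v) = pnorm p v.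
Proof. by apply/le_anti/andP; split; apply: pnorm_mono => i; rewrite mxE normrN. Qed.

Lemma ler_pnormZ n a (v : 'cV[R]_n) : pnorm p (a *: v) <= `|a| * pnorm p v.
Proof.
have := @coord_le_pnorm n; have [[r r1 ->]|->] := exponentP => cv.
  apply: pnorm_le_sum_powR => //.
    by rewrite mulr_ge0 //; exact: powR_ge0.
  rewrite powRM // ?powR_ge0 // -sum_powR_pnorm // mulr_sumr.
  by apply: ler_sum => i _; rewrite mxE normrM powRM.
apply: bigmax_le => [|i _]; first by rewrite mulr_ge0 //; exact: bigmax_ge_id.
by rewrite mxE normrM ler_wpM2l // cv.
Qed.

(** Minkowski's inequality by convexity of [t |-> t^r]: with [a] and [b] the
    norms of [u] and [v], the vector [(|u| + |v|) / (a + b)] is the convex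
    combination, with weights [a / (a + b)] and [b / (a + b)], of the unit
    vectors [|u| / a] and [|v| / b]. *)
Lemma ler_pnormD n (u v : 'cV[R]_n) : pnorm p (u + v) <= pnorm p u + pnorm p v.
Proof.
have [-> | /pnorm_gt0 a0] := eqVneq u 0; first by rewrite add0r lerDr pnorm_ge0.
have [-> | /pnorm_gt0 b0] := eqVneq v 0; first by rewrite addr0 lerDl pnorm_ge0.
move: a0 b0 (@coord_le_pnorm n).
have [[r r1 ->]|->] := exponentP => a0 b0 cv; last first.
  apply: bigmax_le => [|i _]; first by rewrite addr_ge0 ?ltW.
  by rewrite mxE (le_trans (ler_normD _ _)) // lerD ?cv.
have := sum_powR_pnorm v r1; have := sum_powR_pnorm u r1.
move: (pnorm r%:E u) (pnorm r%:E v) a0 b0 => a b a0 b0 sa sb.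
have ab0 : 0 < a + b := addr_gt0 a0 b0.
apply: pnorm_le_sum_powR => //; first exact: ltW.
have t0 : 0 <= a / (a + b) by rewrite divr_ge0 ?ltW.
have t1 : a / (a + b) <= 1 by rewrite ler_pdivrMr // mul1r lerDl ltW.
have tC : 1 - a / (a + b) = b / (a + b) by field; rewrite gt_eqF.
have cvx i : `|(u + v) i 0| `^ r <= (a + b) `^ r *
    (a / (a + b) * (`|u i 0| `^ r / a `^ r) + b / (a + b) * (`|v i 0| `^ r / b `^ r)).
  have := @convex_powR R r r1 (Itv01 t0 t1) (`|u i 0| / a) (`|v i 0| / b).
  rewrite !inE /= !in_itv /= !andbT convRE [X in X `^ _]convRE /=
    [unstable.onem _]tC.
  have -> : a / (a + b) * (`|u i 0| / a) + b / (a + b) * (`|v i 0| / b)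
            = (`|u i 0| + `|v i 0|) / (a + b).
    by field; rewrite !gt_eqF.
  rewrite !powRM ?invr_ge0 ?(ltW a0) ?(ltW b0) ?(ltW ab0) ?addr_ge0 //.
  rewrite !powR_inv ?(ltW a0) ?(ltW b0) ?(ltW ab0) //.
  move=> /(_ (divr_ge0 (normr_ge0 _) (ltW a0)) (divr_ge0 (normr_ge0 _) (ltW b0))).
  rewrite ler_pdivrMr ?powR_gt0 // [leRHS]mulrC => le.
  apply: le_trans le; apply: ge0_ler_powR; rewrite ?nnegrE ?addr_ge0 //.
    exact: le_trans r1.
  by rewrite mxE ler_normD.
apply: le_trans (ler_sum _ (fun i _ => cvx i)) _.
rewrite -mulr_sumr big_split /= -!mulr_sumr -!mulr_suml sa sb.
rewrite !divff ?gt_eqF ?powR_gt0 // !mulr1 -mulrDl divff ?gt_eqF // mulr1 //.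
Qed.

Lemma pnorm0 n : pnorm p (0 : 'cV[R]_n) = 0.
Proof.
apply/le_anti; rewrite pnorm_ge0 andbT -(scale0r 0).
by apply: le_trans (ler_pnormZ _ _) _; rewrite normr0 mul0r.
Qed.

Lemma ler_pnorm_sum n I (r : seq I) (F : I -> 'cV[R]_n) :
  pnorm p (\sum_(i <- r) F i) <= \sum_(i <- r) pnorm p (F i).
Proof.
elim/big_ind2: _ => [|x1 x2 y1 y2 h1 h2|//]; first by rewrite pnorm0.
exact: le_trans (ler_pnormD _ _) (lerD h1 h2).
Qed.

(** On the unit ball [A *m v] is a combination of the columns of [A] with
    coefficients of modulus at most 1; so the supremum defining the induced
    norm is one of a bounded set. *)
Lemma induced_norm_has_ubound m n (A : 'M[R]_(m, n)) :
  has_ubound [set pnorm p (A *m v) | v in [set v | pnorm p v <= 1]].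
Proof.
exists (\sum_j pnorm p (col j A)) => _ [v /= v1 <-].
have -> : A *m v = \sum_j v j 0 *: col j A.
  apply/colP => i; rewrite mxE summxE; apply: eq_bigr => j _.
  by rewrite !mxE mulrC.
apply: le_trans (ler_pnorm_sum _ _) _; apply: ler_sum => j _.
apply: le_trans (ler_pnormZ _ _) _; rewrite ler_piMl ?pnorm_ge0 //.
exact: le_trans (coord_le_pnorm _ _) v1.
Qed.

Lemma induced_norm_ge0 m n (A : 'M[R]_(m, n)) : 0 <= induced_norm p A.
Proof.
apply: le_trans (ub_le_sup (induced_norm_has_ubound A) _); last first.
  by exists 0 => //=; rewrite pnorm0 ler01.
by rewrite pnorm_ge0.
Qed.

Lemma pnorm_mulmx m n (A : 'M[R]_(m, n)) (v : 'cV[R]_n) :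
  pnorm p (A *m v) <= induced_norm p A * pnorm p v.
Proof.
have [/pnorm_eq0 -> | v0] := eqVneq (pnorm p v) 0.
  by rewrite mulmx0 !pnorm0 mulr0.
have {1}-> : v = pnorm p v *: ((pnorm p v)^-1 *: v).
  by rewrite scalerA divff // scale1r.
rewrite -scalemxAr; apply: le_trans (ler_pnormZ _ _) _.
rewrite ger0_norm ?pnorm_ge0 // mulrC ler_wpM2r ?pnorm_ge0 //.
apply: ub_le_sup (induced_norm_has_ubound A) _ _.
exists ((pnorm p v)^-1 *: v) => //=.
apply: le_trans (ler_pnormZ _ _) _.
by rewrite ger0_norm ?invr_ge0 ?pnorm_ge0 // mulVf.
Qed.

End PNorm.

(** * Signatures and the limiting Jacobian *)

(** The diagonal sign matrix; as in the library's signed powers, [true] stands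
    for the sign -1. *)
Definition sgn_mx (R : realType) s (sg : {ffun 'I_s -> bool}) : 'M[R]_s :=
  diag_mx (\row_i (-1) ^+ sg i).

(** The linear map which [abs_map S] coincides with on the closed orthant of
    signs [sg]. *)
Definition selection_mx (R : realType) s (S : 'M[R]_s) (sg : {ffun 'I_s -> bool})
    : 'M[R]_s :=
  1%:M - S *m sgn_mx R sg.

(** [z] lies in the closed orthant of signs [sg]; several [sg] qualify when
    [z] has zero coordinates. *)
Definition compatible (R : realType) s (sg : {ffun 'I_s -> bool})
    (z : 'cV[R]_s) : Prop :=
  forall i, (-1) ^+ sg i * z i 0 = `|z i 0|.

Definition signature (R : realType) s (z : 'cV[R]_s) : {ffun 'I_s -> bool} :=
  [ffun i => z i 0 < 0].

Lemma signature_compatible (R : realType) s (z : 'cV[R]_s) :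
  compatible (signature z) z.
Proof. by move=> i; rewrite ffunE -normrEsign. Qed.

Section LimitingJacobian.
Variables (R : realType) (s : nat) (S : 'M[R]_s).

Lemma sgn_mxE (sg : {ffun 'I_s -> bool}) (v : 'cV[R]_s) i :
  (sgn_mx R sg *m v) i 0 = (-1) ^+ sg i * v i 0.
Proof. by rewrite mul_diag_mx !mxE. Qed.

Lemma selection_mxE (sg : {ffun 'I_s -> bool}) i j :
  selection_mx S sg i j = (i == j)%:R - (-1) ^+ sg j * S i j.
Proof. by rewrite /selection_mx mul_mx_diag !mxE [S i j * _]mulrC. Qed.

Lemma abs_mapE (z : 'cV[R]_s) i :
  abs_map S z i 0 = z i 0 - \sum_j S i j * `|z j 0|.
Proof. by rewrite !mxE; congr (_ - _); apply: eq_bigr => j _; rewrite mxE. Qed.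

Lemma abs_right_increment (x h : R) : 0 < h -> (x < 0 -> h < - x) ->
  `|h + x| - `|x| = (-1) ^+ (x < 0)%R * h.
Proof.
move=> h0; case: ltP => [x0 /(_ isT) hx | x0 _].
  by rewrite !ltr0_norm //; lra.
by rewrite !ger0_norm //; lra.
Qed.

(** If a partial derivative exists, it equals the right derivative, and the
    right derivative of the absolute value exists everywhere, being +1 at 0.
    So no case distinction is needed at points with zero coordinates, where
    [abs_map S] may be differentiable because a column of [S] vanishes. *)
Lemma cjacobian_abs_map (y : 'cV[R]_s) : differentiable (abs_map S) y ->
  cjacobian (abs_map S) y = selection_mx S (signature y).
Proof.
move=> dH; apply/matrixP => i j; rewrite [LHS]mxE selection_mxE ffunE.
have := @diff_derivable R _ _ (abs_map S) y (delta_mx j 0) dH.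
rewrite /derivable => /cvg_dnbhs_at_right cD.
have {}cD := continuous_cvg _ (@coord_continuous R s 1 i 0 _) cD.
apply: (cvg_unique (@Rhausdorff R) (cD _)).
apply: cvg_near_cst.
(* to the right of 0, [h + y_j] keeps the sign of [y_j] *)
have nh : \forall h \near (0 : R)^'+, y j 0 < 0 -> h < - y j 0.
  have [y0|y0] := ltP (y j 0) 0; last by apply: nearW => h /=.
  have : 0 < - y j 0 by rewrite oppr_gt0.
  by move/nbhs_right_lt; apply: filterS.
near=> h.
have h0 : 0 < h by near: h; exact: nbhs_right_gt.
have hy : y j 0 < 0 -> h < - y j 0 by near: h.
have := abs_right_increment h0 hy; set d := (-1) ^+ _ => inc.
rewrite [LHS]mxE [X in _ * X]mxE [X in _ * (_ + X)]mxE /= !abs_mapE.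
rewrite (bigD1 j) //= [X in _ - (_ - X)](bigD1 j) //=.
have -> : \sum_(k | k != j) S i k * `|(h *: delta_mx j 0 + y) k 0|
          = \sum_(k | k != j) S i k * `|y k 0|.
  by apply: eq_bigr => k kj; rewrite !mxE (negPf kj) mulr0 add0r.
rewrite !mxE !eqxx !andbT mulr1.
have -> : `|h + y j 0| = d * h + `|y j 0| by rewrite -inc subrK.
by field; rewrite gt_eqF.
Unshelve. all: by end_near. Qed.

Lemma differentiable_abs (x : R) : x != 0 -> differentiable (fun t : R => `|t|) x.
Proof.
move=> x0; apply/derivable1_diffP.
case: (ltgtP x 0) x0 => // x0 _.
  apply: (@near_eq_derivable _ _ _ (fun t => - t)).
    by near=> t; rewrite ltr0_norm //; near: t; exact: (@cvgr_lt _ _ _ _ id x).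
  exact: derivableN.
apply: (@near_eq_derivable _ _ _ (fun t => t)).
  by near=> t; rewrite gtr0_norm //; near: t; exact: (@cvgr_gt _ _ _ _ id x).
exact: derivable_id.
Unshelve. all: by end_near. Qed.

Lemma differentiable_abs_map (y : 'cV[R]_s) : (forall i, y i 0 != 0) ->
  differentiable (abs_map S) y.
Proof.
move=> y0.
have -> : abs_map S = id \- \sum_(j < s) (fun z : 'cV[R]_s => `|z j 0| *: col j S).
  apply/funext => z; rewrite /= /abs_map; congr (_ - _).
  apply/colP => i; rewrite fct_sumE summxE mxE; apply: eq_bigr => j _.
  by rewrite !mxE mulrC.
apply: differentiableB; first by [].
apply: differentiable_sum => j; apply: differentiableZl.
apply: (@differentiable_comp _ _ _ _ (fun z : 'cV[R]_s => z j 0 : R) (fun t : R => `|t|)).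
  exact: differentiable_coord.
exact: differentiable_abs.
Qed.

(** The Jacobians near [z] belong to the finite, hence closed, set of matrices
    [selection_mx S sg] with [sg] compatible with [z]: signs of nonzero
    coordinates of [z] persist nearby, and zero coordinates put no constraint
    on [sg]. *)
Lemma limiting_jacobian_selection (z : 'cV[R]_s) (A : 'M[R]_s) :
  limiting_jacobian (abs_map S) z A ->
  exists2 sg, compatible sg z & A = selection_mx S sg.
Proof.
move=> [y [dy yz JA]].
have fin : finite_set [set selection_mx S sg | sg in [set sg | compatible sg z]].
  exact: finite_image.
have cl := (@accessible_finite_set_closed _).1
  (hausdorff_accessible (@norm_hausdorff _ _)) _ fin.
suff ne : \forall k \near \oo,
    [set selection_mx S sg | sg in [set sg | compatible sg z]]
      (cjacobian (abs_map S) (y k)).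
  by have [sg csg <-] := closed_cvg _ cl ne _ JA; exists sg.
have sgE i : \forall k \near \oo, (-1) ^+ (y k i 0 < 0)%R * z i 0 = `|z i 0|.
  have yi : y k i 0 @[k --> \oo] --> z i 0.
    exact: continuous_cvg _ (@coord_continuous R s 1 i 0 _) yz.
  case: (ltgtP (z i 0) 0) => zi.
  - near=> k; have -> : y k i 0 < 0 by near: k; exact: cvgr_lt yi _ zi.
    by rewrite mulN1r ltr0_norm.
  - near=> k; have : 0 < y k i 0 by near: k; exact: cvgr_gt yi _ zi.
    by move=> /lt_gtF ->; rewrite mul1r gtr0_norm.
  - by near=> k; rewrite zi mulr0 normr0.
near=> k; have sk : forall i, (-1) ^+ (y k i 0 < 0)%R * z i 0 = `|z i 0|.
  by near: k; exact: (filter_forall _ sgE).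
exists (signature (y k)); last by rewrite cjacobian_abs_map.
by move=> i; rewrite ffunE.
Unshelve. all: by end_near. Qed.

(** Approach [z] from inside an open orthant whose closure contains [z]: there
    [abs_map S] is linear and its Jacobian constant. *)
Lemma limiting_jacobian_neq0 (z : 'cV[R]_s) :
  limiting_jacobian (abs_map S) z !=set0.
Proof.
pose u : 'cV[R]_s := \col_i (-1) ^+ (z i 0 < 0)%R.
pose y k := z + harmonic k *: u.
have yE k i : y k i 0 = z i 0 + (harmonic k : R) * (-1) ^+ (z i 0 < 0)%R.
  by rewrite !mxE.
have h0 k : 0 < harmonic k :> R by rewrite /harmonic invr_gt0 ltr0n.
have ylt k i : (y k i 0 < 0) = (z i 0 < 0).
  rewrite yE; have := h0 k; case: (ltP (z i 0) 0) => zi hk.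
    by rewrite expr1 mulrN1; lra.
  by rewrite expr0 mulr1; lra.
have dy k : differentiable (abs_map S) (y k).
  apply: differentiable_abs_map => i.
  rewrite yE; have := h0 k; case: (ltP (z i 0) 0) => zi hk.
    by rewrite expr1 mulrN1; lra.
  by rewrite expr0 mulr1; lra.
exists (selection_mx S (signature z)), y; split=> //.
  rewrite -[X in _ --> X]addr0 -(scale0r u).
  by apply: cvgD; [exact: cvg_cst | apply: cvgZr_tmp; exact: cvg_harmonic].
have -> : (fun k => cjacobian (abs_map S) (y k)) = cst (selection_mx S (signature z)).
  apply/funext => k; rewrite cjacobian_abs_map //=; congr selection_mx.
  by apply/ffunP => i; rewrite !ffunE ylt.
exact: cvg_cst.
Qed.

End LimitingJacobian.

(** * Newton steps *)

Lemma sign_defect_le (R : realType) (b : bool) (x y : R) :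
  (-1) ^+ b * x = `|x| -> `|(-1) ^+ b * y - `|y| | <= 2 * `|y - x|.
Proof.
case: b; rewrite ?expr0 ?expr1 ?mulN1r ?mul1r => xE.
  have x0 : x <= 0 by rewrite -oppr_ge0 xE.
  have [y0|y0] := leP 0 y; last by rewrite (ltr0_norm y0) subrr normr0 mulr_ge0.
  rewrite (ger0_norm y0) ler0_norm; last by lra.
  by have := ler_norm (y - x); lra.
have x0 : 0 <= x by rewrite xE.
have [y0|y0] := leP 0 y; first by rewrite (ger0_norm y0) subrr normr0 mulr_ge0.
rewrite (ltr0_norm y0) ler0_norm; last by lra.
by have := ler_norm (- (y - x)); rewrite normrN; lra.
Qed.

(** The contraction factor [2 r / (1 - r)] of a Newton step is below 1 when
    [r < 1/3]. *)
Lemma strict_decrease (R : realType) (r a b : R) : r < 1 / 3 ->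
  (1 - r) * a <= 2 * r * b -> 0 < b -> a < b.
Proof.
move=> r3 le b0.
have : 0 < (1 - r * 3) * b by rewrite mulr_gt0 // subr_gt0; lra.
have r1 : 0 < 1 - r by lra.
by rewrite -(ltr_pM2l r1); nra.
Qed.

Section Newton.
Variables (R : realType) (s : nat) (S : 'M[R]_s) (p : \bar R).
Hypothesis p1 : (1 <= p)%E.
Local Notation rho := (induced_norm p S).
Local Notation H := (abs_map S).
Implicit Types (z w v c : 'cV[R]_s) (sg : {ffun 'I_s -> bool}).

(** A sign matrix does not change the p-norm, so [S D] has norm at most
    [rho]. *)
Lemma selection_mx_lower sg v :
  (1 - rho) * pnorm p v <= pnorm p (selection_mx S sg *m v).
Proof.
have sgn : pnorm p (sgn_mx R sg *m v) <= pnorm p v.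
  by apply: pnorm_mono => // i; rewrite sgn_mxE normrM normrX normrN1 expr1n mul1r.
have Sv : pnorm p (S *m (sgn_mx R sg *m v)) <= rho * pnorm p v.
  apply: le_trans (pnorm_mulmx _ _ _) _ => //.
  by apply: ler_wpM2l => //; exact: induced_norm_ge0.
have := ler_pnormD p1 (selection_mx S sg *m v) (S *m (sgn_mx R sg *m v)).
rewrite {2}/selection_mx mulmxBl mul1mx -mulmxA subrK; lra.
Qed.

Lemma selection_mx_unit sg : rho < 1 -> selection_mx S sg \in unitmx.
Proof.
move=> rho1; rewrite -unitmx_tr -row_free_unit -kermx_eq0; apply/eqP/row_matrixP => i.
rewrite row0; set u := row i _.
have uA : selection_mx S sg *m u^T = 0.
  by rewrite -[selection_mx _ _]trmxK -trmx_mul -row_mul mulmx_ker row0 trmx0.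
have := selection_mx_lower sg u^T; rewrite uA pnorm0 // => le0.
apply: trmx_inj; rewrite trmx0; apply: (pnorm_eq0 p1).
apply/le_anti; rewrite pnorm_ge0 andbT.
by rewrite -(pmulr_rle0 _ (_ : 0 < 1 - rho)) ?subr_gt0.
Qed.

Lemma selection_mx_compatible sg z : compatible sg z -> selection_mx S sg *m z = H z.
Proof.
move=> sgz; rewrite mulmxBl mul1mx -mulmxA; congr (_ - _ *m _).
by apply/colP => i; rewrite sgn_mxE sgz mxE.
Qed.

(** The difference is [S] applied to [D w - |w|], which vanishes in the
    coordinates where [D] agrees with [w]; in the others [0] lies between
    [w_i] and [z_i], whence the modulus [2 |w_i| <= 2 |w_i - z_i|]. *)
Lemma selection_mx_defect sg z w : compatible sg z ->
  pnorm p (H w - selection_mx S sg *m w) <= 2 * rho * pnorm p (w - z).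
Proof.
move=> sgz.
have -> : H w - selection_mx S sg *m w = S *m (sgn_mx R sg *m w - cabs w).
  by rewrite mulmxBl mul1mx -mulmxA /abs_map mulmxBr opprB addrC addrA subrK.
apply: le_trans (pnorm_mulmx _ _ _) _ => //.
rewrite [2 * rho]mulrC -mulrA; apply: ler_wpM2l; first exact: induced_norm_ge0.
rewrite -[X in X * _](ger0_norm (ler0n R 2)).
apply: le_trans (ler_pnormZ p1 2 _).
apply: pnorm_mono => // i.
by rewrite mxE sgn_mxE !mxE normrM [`|2|]ger0_norm // sign_defect_le.
Qed.

(** [A (z' - w) = H w - A w] is a defect. *)
Lemma selection_step_error sg z w c : compatible sg z -> H w = c ->
  forall z', selection_mx S sg *m z' = c ->
  (1 - rho) * pnorm p (z' - w) <= 2 * rho * pnorm p (z - w).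
Proof.
move=> sgz Hw z' Az'; apply: le_trans (selection_mx_lower sg _) _.
rewrite mulmxBr Az' -Hw -[z - w]opprB pnormN //.
exact: selection_mx_defect.
Qed.

(** [H z' - c = H z' - A z'] is a defect, bounded in terms of the step length
    [z' - z]; the latter is controlled by [A (z' - z) = c - H z]. *)
Lemma selection_step_residual sg z c : rho < 1 -> compatible sg z ->
  forall z', selection_mx S sg *m z' = c ->
  (1 - rho) * pnorm p (H z' - c) <= 2 * rho * pnorm p (H z - c).
Proof.
move=> rho1 sgz z' Az'.
have d := selection_mx_defect z' sgz; rewrite Az' in d.
have l := selection_mx_lower sg (z' - z).
rewrite mulmxBr Az' (selection_mx_compatible sgz) -[c - H z]opprB pnormN // in l.
have rho0 := induced_norm_ge0 p1 S.
have : (1 - rho) * pnorm p (H z' - c) <= (1 - rho) * (2 * rho * pnorm p (z' - z)).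
  by rewrite ler_wpM2l // subr_ge0 ltW.
move/le_trans; apply; rewrite mulrCA; apply: ler_wpM2l => //.
by rewrite mulr_ge0.
Qed.

Hypothesis rho3 : rho < 1 / 3.

Let rho1 : rho < 1. Proof. by apply: lt_trans rho3 _; lra. Qed.

(** A solution [z] is its own Newton step, so the error bound from [z] to
    another solution [w] compares [z - w] with itself. *)
Lemma abs_map_inj c z w : H w = c -> H z = c -> z = w.
Proof.
move=> Hw Hz; have sgz : compatible (signature z) z by exact: signature_compatible.
have := selection_step_error sgz Hw (etrans (selection_mx_compatible sgz) Hz).
have [/eqP|zw] := eqVneq (z - w) 0; first by rewrite subr_eq0 => /eqP.
by move/(strict_decrease rho3)/(_ (pnorm_gt0 p1 zw)); rewrite ltxx.
Qed.

(** Existence without completeness: minimise the residual over the finitely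
    many solutions of the linear systems; a Newton step from a minimiser that
    is not a solution would improve on it. *)
Lemma abs_map_surj c : exists w, H w = c.
Proof.
pose sol sg := invmx (selection_mx S sg) *m c.
have solE sg : selection_mx S sg *m sol sg = c.
  by rewrite mulmxA mulmxV ?mul1mx // selection_mx_unit.
pose sg0 : {ffun 'I_s -> bool} := [ffun=> false].
pose res sg := pnorm p (H (sol sg) - c).
have [m _ minm] := @Order.TotalTheory.arg_minP _ _ _ sg0 xpredT res isT.
exists (sol m); apply/eqP; rewrite -subr_eq0; apply/negPn/negP => ne0.
have sgz : compatible (signature (sol m)) (sol m) by exact: signature_compatible.
have := selection_step_residual rho1 sgz (solE (signature (sol m))).
move/(strict_decrease rho3)/(_ (pnorm_gt0 p1 ne0)).
by rewrite ltNge (minm (signature (sol m)) isT).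
Qed.

Lemma newton_step_selection c z z' A : limiting_jacobian H z A ->
  z' = z - invmx A *m (H z - c) ->
  exists2 sg, compatible sg z & selection_mx S sg *m z' = c.
Proof.
move=> /limiting_jacobian_selection [sg sgz ->] ->; exists sg => //.
rewrite mulmxBr mulmxA mulmxV ?selection_mx_unit // mul1mx.
by rewrite selection_mx_compatible // opprB addrC subrK.
Qed.

Lemma newton_step_error c z z' w A : limiting_jacobian H z A -> H w = c ->
  z' = z - invmx A *m (H z - c) ->
  pnorm p (z' - w) <= pnorm p (z - w) ?= iff (z == w).
Proof.
move=> zA Hw /(newton_step_selection zA) [sg sgz Az'].
have e := selection_step_error sgz Hw Az'.
apply/leifP; have [zw|zw] := eqVneq; last first.
  by apply: (strict_decrease rho3 e); rewrite pnorm_gt0 // subr_eq0.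
move: e; rewrite zw subrr pnorm0 // mulr0 pmulr_rle0 ?subr_gt0 // => e.
by rewrite eq_le e pnorm_ge0.
Qed.

Lemma newton_step_residual c z z' w A : limiting_jacobian H z A -> H w = c ->
  z' = z - invmx A *m (H z - c) ->
  pnorm p (H z' - c) <= pnorm p (H z - c) ?= iff (z == w).
Proof.
move=> zA Hw z'E; apply/leifP; have [zw|zw] := eqVneq.
  by rewrite z'E zw Hw subrr mulmx0 subr0 Hw subrr.
have [sg sgz Az'] := newton_step_selection zA z'E.
apply: (strict_decrease rho3 (selection_step_residual rho1 sgz Az')).
by rewrite pnorm_gt0 // subr_eq0; apply: contra_neq zw => /(abs_map_inj Hw).
Qed.

(** Pigeonhole: as long as the solution is not reached, residuals decrease
    strictly and so the iterates are distinct, while [z k.+1] depends only on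
    the sign vector used at step [k]. *)
Lemma newton_finite_termination c z0 w (z : nat -> 'cV[R]_s) : H w = c ->
  newton_iteration H c z0 z -> exists N, forall k, (N <= k)%N -> z k = w.
Proof.
move=> Hw [_ step].
have stay k : z k = w -> z k.+1 = w.
  by have [A _ ->] := step k => ->; rewrite Hw subrr mulmx0 subr0.
suff [N zN] : exists N, z N = w.
  exists N => k /subnK <-; elim: (k - N)%N => [//|m IH].
  by rewrite addSn; exact: stay.
apply: contrapT => /forallNP zne.
have lt k : pnorm p (H (z k.+1) - c) < pnorm p (H (z k) - c).
  have [A zA zS] := step k; rewrite (lt_leif (newton_step_residual zA Hw zS)).
  by apply/eqP; exact: zne.
have zinj i j : (i < j)%N -> z i <> z j.
  move=> ij zij.
  have := homo_ltn (r := fun a b : R => b < a)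
    (fun _ _ _ ab bc => lt_trans bc ab) lt ij.
  by rewrite zij ltxx.
have /choice [sg sgE] : forall k, exists sg, selection_mx S sg *m z k.+1 = c.
  move=> k; have [A zA zS] := step k.
  by have [sg _ ?] := newton_step_selection zA zS; exists sg.
have sginj : injective (fun k : 'I_(#|{ffun 'I_s -> bool}|.+1) => sg k).
  move=> i j sgij; apply/val_inj => /=.
  have zE : z i.+1 = z j.+1.
    apply: (can_inj (mulKmx (selection_mx_unit (sg i) rho1))).
    by rewrite [LHS]sgE sgij sgE.
  case: (ltngtP i j) => // ij; first by case: (zinj i.+1 j.+1 ij).
  by case: (zinj j.+1 i.+1 ij).
by have := leq_card _ sginj; rewrite card_ord ltnn.
Qed.

End Newton.

(** * The generalized Newton iteration *)

Theorem proposition7p3 (R : realType) (n s : nat)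
    (F : 'cV[R]_n -> 'cV[R]_n) (c : 'cV[R]_s) (b : 'cV[R]_n)
    (Z : 'M[R]_(s, n)) (L : 'M[R]_s) (J : 'M[R]_n) (Y : 'M[R]_(n, s))
    (p : \bar R) :
  abs_normal_form F c b Z L J Y ->
  \det J != 0 ->
  (1 <= p)%E ->
  let S := schur_complement Z L J Y in
  let H := abs_map S in
  induced_norm p S < 1 / 3 ->
  (* the iteration is well defined *)
  (forall z : 'cV[R]_s, limiting_jacobian H z !=set0 /\
     forall A : 'M[R]_s, limiting_jacobian H z A -> A \in unitmx) /\
  (forall chat : 'cV[R]_s, exists zstar : 'cV[R]_s,
     [/\ H zstar = chat,
         forall z : 'cV[R]_s, H z = chat -> z = zstar &
         forall (z0 : 'cV[R]_s) (z : nat -> 'cV[R]_s),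
           newton_iteration H chat z0 z ->
           [/\ exists N : nat, forall k : nat, (N <= k)%N -> z k = zstar,
               forall k : nat, pnorm p (z k.+1 - zstar)
                 <= pnorm p (z k - zstar) ?= iff (z k == zstar) &
               forall k : nat, pnorm p (H (z k.+1) - chat)
                 <= pnorm p (H (z k) - chat) ?= iff (z k == zstar)]]).
Proof.
move=> _ _ p1 S H rho3.
have rho1 : induced_norm p S < 1 by apply: lt_trans rho3 _; lra.
split=> [z|c'].
  split; first exact: limiting_jacobian_neq0.
  by move=> A /limiting_jacobian_selection [sg _ ->]; exact: (selection_mx_unit p1).
have [w Hw] := abs_map_surj p1 rho3 c'; exists w; split=> //.
  by move=> z; exact: (abs_map_inj p1 rho3 Hw).
move=> z0 z it; split; first exact: (newton_finite_termination p1 rho3 Hw it).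
  by move=> k; have [A zA zS] := it.2 k; exact: (newton_step_error p1 rho3 zA Hw zS).
by move=> k; have [A zA zS] := it.2 k; exact: (newton_step_residual p1 rho3 zA Hw zS).
Qed.
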